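(* The inclusions $cs_0^{\lambda}\subset cs^{\lambda}\subset bs^{\lambda}$ hold and both are strict.
   Context: $\mathbb{N}=\{0,1,2,\dots\}$ and $w=\mathbb{C}^{\mathbb{N}}$ is the space of all complex sequences. $\lambda=(\lambda_k)_{k\in\mathbb{N}}$ is a fixed strictly increasing sequence of positive reals tending to infinity, with the convention $\lambda_{-1}=0$. For $x=(x_k)\in w$ put $\Lambda(x)=(\Lambda_n(x))_{n\in\mathbb{N}}$, $\Lambda_n(x)=\frac{1}{\lambda_n}\sum_{k=0}^{n}(\lambda_k-\lambda_{k-1})x_k$. $cs$, $cs_0$, $bs$ are the spaces of sequences $x\in w$ whose sequence of partial sums $\left(\sum_{n=0}^m x_n\right)_m$ is, respectively, convergent, convergent to $0$, bounded. Define $cs^{\lambda}=\{x\in w:\Lambda(x)\in cs\}$, $cs_0^{\lambda}=\{x\in w:\Lambda(x)\in cs_0\}$, $bs^{\lambda}=\{x\in w:\Lambda(x)\in bs\}$. *)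

(* Defs.v *)
From HB Require Import structures.
From mathcomp Require Import all_boot all_order all_algebra.
From mathcomp Require Import all_classical all_reals all_analysis.
From mathcomp Require Import complex.

Set Implicit Arguments.
Unset Strict Implicit.
Unset Printing Implicit Defensive.

Import Order.TTheory GRing.Theory Num.Theory numFieldNormedType.Exports.

Local Open Scope classical_set_scope.
Local Open Scope ring_scope.
Local Open Scope complex_scope.

(* The complex numbers are R[i]; the alias R[i]^o carries the topology and the
   normed-module structure induced by the modulus. *)

Definition partial_sums (R : realType) (x : nat -> R[i]) : nat -> R[i] :=
  fun m => \sum_(n < m.+1) x n.

Definition cs (R : realType) : set (nat -> R[i]) :=
  [set x | cvgn (partial_sums x : nat -> R[i]^o)].

Definition cs0 (R : realType) : set (nat -> R[i]) :=
  [set x | (partial_sums x : nat -> R[i]^o) @ \oo --> (0 : R[i]^o)].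

Definition bs (R : realType) : set (nat -> R[i]) :=
  [set x | bounded_fun (partial_sums x : nat -> R[i]^o)].

(* lambda_{k-1}, with the convention lambda_{-1} = 0 *)
Definition lambda_prev (R : realType) (lambda : nat -> R) (k : nat) : R :=
  if k is k'.+1 then lambda k' else 0.

Definition Lambda (R : realType) (lambda : nat -> R) (x : nat -> R[i]) :
    nat -> R[i] :=
  fun n => (lambda n)^-1%:C *
    \sum_(k < n.+1) (lambda k - lambda_prev lambda k)%:C * x k.

Definition cs_lambda (R : realType) (lambda : nat -> R) : set (nat -> R[i]) :=
  [set x | cs (Lambda lambda x)].

Definition cs0_lambda (R : realType) (lambda : nat -> R) : set (nat -> R[i]) :=
  [set x | cs0 (Lambda lambda x)].

Definition bs_lambda (R : realType) (lambda : nat -> R) : set (nat -> R[i]) :=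
  [set x | bs (Lambda lambda x)].

(* Main.v *)
(* Both x |-> Lambda x and y |-> partial_sums y are onto, hence every sequence is
   the sequence of partial sums of some Lambda x. The constant sequence 1 and
   the sequence (-1)^n then separate the three spaces. *)

Require Import Defs.
From mathcomp Require Import all_boot all_order all_algebra.
From mathcomp Require Import all_classical all_reals all_analysis.
From mathcomp Require Import complex.
Import Order.TTheory GRing.Theory Num.Theory numFieldNormedType.Exports.
Local Open Scope classical_set_scope.
Local Open Scope ring_scope.

Lemma partial_sums_surj {R : realType} (s : nat -> R[i]) :
  exists y, partial_sums y = s.
Proof.
exists (fun n => if n is n'.+1 then s n - s n' else s 0%N).
apply/funext => m; rewrite /partial_sums; elim: m => [|m IHm].
  by rewrite big_ord_recr big_ord0 /= add0r.
by rewrite big_ord_recr /= IHm addrC subrK.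
Qed.

(* x is found by differencing lambda_k y_k and dividing by the (nonzero)
   increments of lambda. *)
Lemma Lambda_surj {R : realType} {lambda : nat -> R} (y : nat -> R[i]) :
  (forall k, 0 < lambda k) -> increasing_seq lambda ->
  exists x, Lambda lambda x = y.
Proof.
move=> lambda_gt0 lambda_incr.
have lambda_neq0 k : (lambda k)%:C%C != 0.
  by rewrite fmorph_eq0 gt_eqF.
have dlambda_neq0 k : (lambda k - lambda_prev lambda k)%:C%C != 0.
  rewrite fmorph_eq0 subr_eq0 gt_eqF //.
  (* At index 0 the increment is [lambda 0] itself, positive by hypothesis. At later indices,
     [increasing_seq] is an equivalence between the two orders [<=], which forces strict growth. *)
  case: k => [|k] /=; first exact: lambda_gt0.
  by rewrite (leW_mono lambda_incr); exact: ltnSn.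
have [u uE] := partial_sums_surj (fun k => (lambda k)%:C%C * y k).
exists (fun k => u k / (lambda k - lambda_prev lambda k)%:C%C).
apply/funext => n; rewrite /Lambda.
under eq_bigr do rewrite mulrC divfK //.
have := congr1 (@^~ n) uE; rewrite /partial_sums /= => ->.
by rewrite fmorphV mulKf ?lambda_neq0.
Qed.

(** Shifting the index by one negates the sequence, so a limit would equal its own opposite and
    hence be 0, whereas every term has modulus 1. *)
Lemma sign_not_cvg (K : numFieldType) :
  ~ cvgn ((fun n => (-1) ^+ n) : nat -> K^o).
Proof.
set s := (s in cvgn s) => s_cvg.
have sS_cvg : (fun n => s n.+1) @ \oo --> limn s by rewrite (cvg_shiftS s).
have sN_cvg : (fun n => s n.+1) @ \oo --> - limn s.
  have -> : (fun n => s n.+1) = \- s.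
    by apply/funext => n; rewrite /s /= exprS mulN1r.
  exact: cvgN.
have lim0 : limn s = 0.
  apply/eqP; rewrite -eqNr; apply/eqP.
  exact: (norm_cvg_unique sN_cvg sS_cvg).
have : (fun n => `|s n| : K^o) @ \oo --> (0 : K^o).
  by rewrite -(normr0 K^o) -lim0; exact: cvg_norm.
have -> : (fun n => `|s n| : K^o) = fun=> 1.
  by apply/funext => n; rewrite /s normrX normrN1 expr1n.
move=> /(norm_cvg_unique (cvg_cst (1 : K^o))) /eqP.
by rewrite oner_eq0.
Qed.

Theorem theorem3p2 (R : realType) (lambda : nat -> R)
    (lambda_gt0 : forall k, 0 < lambda k)
    (lambda_incr : increasing_seq lambda)
    (lambda_pinfty : lambda @ \oo --> +oo) :
  cs0_lambda lambda `<` cs_lambda lambda /\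
  cs_lambda lambda `<` bs_lambda lambda.
Proof.
have solve (s : nat -> R[i]) : exists x, partial_sums (Lambda lambda x) = s.
  have [y <-] := partial_sums_surj s.
  by have [x <-] := Lambda_surj y lambda_gt0 lambda_incr; exists x.
split; split.
- by move=> x; exact: cvgP.
(* Strictness means that the reverse inclusion fails; here it would make the constant sequence 1
   tend to 0. *)
- have [x xE] := solve (fun=> 1) => /(_ x).
  rewrite /cs_lambda /cs0_lambda /cs /cs0 /= xE => /(_ (is_cvg_cst _)).
  move=> /(norm_cvg_unique (cvg_cst (1 : R[i]^o))) /eqP.
  by rewrite oner_eq0.
- by move=> x; exact: cvg_seq_bounded.
- have [x xE] := solve (fun n => (-1) ^+ n) => /(_ x).
  rewrite /cs_lambda /bs_lambda /cs /bs /= xE => cs_x.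
  apply: (@sign_not_cvg R[i]); apply: cs_x.
  (* [bounded_fun] asks that all sufficiently large [M] be bounds; since the terms have modulus 1,
     the threshold 1 works. *)
  exists 1; split; first exact: real1.
  move=> M M_gt1 n _ /=.
  by rewrite normrX normrN1 expr1n ltW.
Qed.
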